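(* Let $G$ be a torsionfree abelian group and let $R$ be a commutative Noetherian $G$-graded ring. Let $I$ be an ideal of $R$ which is radical but not $G$-graded. Then $ir_R(I)\geq ir_R(I^* )$. Equality holds if and only if the map $\mathfrak{p}\mapsto\mathfrak{p}^*$ induces a bijection between $Min(I)$ and $Min(I^* )$.
   Context: A ring $R$ is $G$-graded if $R=\bigoplus_{g\in G}R_g$ with additive subgroups $R_g$ satisfying $R_gR_h\subset R_{g+h}$. For an ideal $I\subset R$, not necessarily graded, $I^*$ denotes the ideal of $R$ generated by all homogeneous elements contained in $I$. $Min(J)$ denotes the set of minimal primes over an ideal $J$. An ideal $I$ of $R$ is irreducible if whenever $I_1,I_2$ are ideals of $R$ with $I_1\cap I_2=I$, then $I_1=I$ or $I_2=I$. The index of reducibility of $I$ in $R$ is $ir_R(I)=\min\{r: I=\bigcap_{i=1}^r I_i,\ I_i \text{ irreducible ideals of } R\}$. *)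

(* Defs.v *)
From mathcomp Require Import all_boot all_algebra.
From mathcomp Require Import boolp classical_sets functions.

Set Implicit Arguments.
Unset Strict Implicit.
Unset Printing Implicit Defensive.

Import GRing.Theory.
Local Open Scope classical_set_scope.
Local Open Scope ring_scope.

Definition torsionfree (G : zmodType) : Prop :=
  forall (g : G) (n : nat), (0 < n)%N -> g *+ n = 0 -> g = 0.

Section Ideals.
Variable R : comPzRingType.
Implicit Types I J P Q : set R.

(* Unlike the library's [idealr_closed], this allows the unit ideal, which the
   definition of irreducibility below quantifies over. *)
Definition is_ideal I : Prop :=
  [/\ I 0, forall x y, I x -> I y -> I (x + y) & forall a x, I x -> I (a * x)].

Definition noetherian : Prop :=
  forall J : nat -> set R,
    (forall n, is_ideal (J n)) -> (forall n, J n `<=` J n.+1) ->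
    exists n, forall m, (n <= m)%N -> J m = J n.

Definition radical I : set R := [set x | exists n : nat, I (x ^+ n)].

Definition is_radical_ideal I : Prop := is_ideal I /\ radical I = I.

Definition is_prime P : Prop :=
  [/\ is_ideal P, ~ P 1 & forall x y, P (x * y) -> P x \/ P y].

Definition Min J : set (set R) :=
  [set P | [/\ is_prime P, J `<=` P &
    forall Q, is_prime Q -> J `<=` Q -> Q `<=` P -> Q = P]].

Definition is_irreducible I : Prop :=
  is_ideal I /\
  forall I1 I2, is_ideal I1 -> is_ideal I2 -> I1 `&` I2 = I ->
    I1 = I \/ I2 = I.

Definition irreducible_decomposition I (r : nat) : Prop :=
  exists J : 'I_r -> set R,
    (forall i, is_irreducible (J i)) /\ I = \bigcap_(i in [set: 'I_r]) J i.

Definition is_index_of_reducibility I (r : nat) : Prop :=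
  irreducible_decomposition I r /\
  forall s : nat, irreducible_decomposition I s -> (r <= s)%N.

(* The value 0 is a junk value when I has no irreducible decomposition; by
   [irP] this does not happen for ideals of Noetherian rings.  It is also the
   value at the unit ideal, which is the empty intersection. *)
Definition ir I : nat := xget 0%N (is_index_of_reducibility I).

Lemma noetherian_ind (P : set R -> Prop) : noetherian ->
  (forall I, is_ideal I ->
     (forall J, is_ideal J -> I `<=` J -> J <> I -> P J) -> P I) ->
  forall I, is_ideal I -> P I.
Proof.
move=> noeth step I idI; apply: contrapT => nPI.
pose T := {J : set R | is_ideal J /\ ~ P J}.
have next (t : T) : exists u : T, sval t `<=` sval u /\ sval u <> sval t.
  case: t => J [idJ nPJ] /=; apply: contrapT => none; apply: nPJ.
  apply: step => // K idK JK neq; apply: contrapT => nPK; apply: none.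
  by exists (exist _ K (conj idK nPK)).
have [f fP] := choice next.
pose u n := iter n f (exist _ I (conj idI nPI)).
have [n /(_ n.+1 (leqnSn n))] : exists n, forall m, (n <= m)%N ->
    sval (u m) = sval (u n).
  apply: (noeth (fun n => sval (u n))) => n; first by case: (svalP (u n)).
  by case: (fP (u n)).
by case: (fP (u n)).
Qed.

Lemma irreducible_decomposition_exists I :
  noetherian -> is_ideal I -> exists r, irreducible_decomposition I r.
Proof.
move=> noeth; move: I; apply: noetherian_ind => // I idI IH.
case: (pselect (is_irreducible I)) => [irrI|nirrI].
  by exists 1%N, (fun=> I); split=> //; rewrite bigcap_const //; exists ord0.
have [I1 [I2 [id1 id2 eI n1 n2]]] : exists I1 I2,
    [/\ is_ideal I1, is_ideal I2, I1 `&` I2 = I, I1 <> I & I2 <> I].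
  apply: contrapT => none; apply: nirrI; split=> // I1 I2 id1 id2 eI.
  apply: contrapT => /not_orP[n1 n2]; apply: none.
  by exists I1, I2.
have [|r1 [J1 [irr1 e1]]] := IH I1 id1 _ n1; first by rewrite -eI => x [].
have [|r2 [J2 [irr2 e2]]] := IH I2 id2 _ n2; first by rewrite -eI => x [].
exists (r1 + r2)%N.
exists (fun i => match fintype.split i with inl j => J1 j | inr j => J2 j end).
split=> [i|]; first by case: (fintype.split i).
rewrite -eI e1 e2; apply/seteqP; split=> x.
  by move=> [x1 x2] i _; case: (fintype.split i) => j; [apply: x1|apply: x2].
move=> xJ; split=> j _.
  by have := xJ (lshift r2 j) Logic.I; rewrite (unsplitK (inl j)).
by have := xJ (rshift r1 j) Logic.I; rewrite (unsplitK (inr j)).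
Qed.

Lemma irP I : noetherian -> is_ideal I -> is_index_of_reducibility I (ir I).
Proof.
move=> noeth idI.
have ex : exists r, `[< irreducible_decomposition I r >].
  have [r rP] := irreducible_decomposition_exists noeth idI.
  by exists r; apply/asboolP.
case: (ex_minnP ex) => r /asboolP rP rmin.
apply: (@xgetPex _ 0%N (is_index_of_reducibility I)); exists r; split=> // s sP.
by apply: rmin; apply/asboolP.
Qed.

End Ideals.

Section Gradings.
Variables (G : zmodType) (R : comPzRingType).

(* The last two fields say that R is the internal direct sum of the A g. *)
Record is_grading (A : G -> set R) : Prop := {
  grading0 : forall g, A g 0;
  gradingB : forall g x y, A g x -> A g y -> A g (x - y);
  gradingM : forall g h x y, A g x -> A h y -> A (g + h) (x * y);
  grading_span : forall x, exists (s : seq G) (c : G -> R),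
    [/\ uniq s, forall g, g \in s -> A g (c g) & x = \sum_(g <- s) c g];
  grading_free : forall (s : seq G) (c : G -> R),
    uniq s -> (forall g, g \in s -> A g (c g)) -> \sum_(g <- s) c g = 0 ->
    forall g, g \in s -> c g = 0
}.

Variable A : G -> set R.

Definition homogeneous : set R := [set x | exists g, A g x].

(* I is the direct sum of the subgroups I `&` A g. *)
Definition is_graded_ideal (I : set R) : Prop :=
  is_ideal I /\
  forall x, I x -> exists (s : seq G) (c : G -> R),
    [/\ uniq s, forall g, g \in s -> (I `&` A g) (c g)
      & x = \sum_(g <- s) c g].

Definition star (I : set R) : set R :=
  smallest (@is_ideal R) (I `&` homogeneous).

End Gradings.

(* Main.v *)
Require Import Defs.
From mathcomp Require Import all_boot all_algebra.
From mathcomp Require Import boolp classical_sets functions.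

Set Implicit Arguments.
Unset Strict Implicit.
Unset Printing Implicit Defensive.

Import GRing.Theory.
Local Open Scope classical_set_scope.
Local Open Scope ring_scope.

(** Over a Noetherian ring a radical ideal [I] is the intersection of its
    minimal primes, and [ir I] counts them.  Irreducible ideals are primary, so
    passing to radicals turns a shortest irreducible decomposition of [I] into a
    decomposition of the same length into primes ([radical_ir_primes]).  Primes
    are irreducible, so such a decomposition is irredundant, and an irredundant
    intersection of finitely many primes lists each minimal prime exactly once
    ([ir_primes_Min]).

    The operation [star A] keeps the elements all of whose homogeneous
    components lie in the ideal ([starE]); hence it commutes with intersections
    ([star_bigcap]).  It also preserves primes ([star_prime]): a torsionfree
    abelian group carries a compatible total order ([torsionfree_order]), and if
    [x] and [y] are outside [star A P], the product of their largest components
    outside [P] is, modulo [P], a component of [x * y].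

    So if [I] is the intersection of [ir I] primes [P i], then [star A I] is the
    intersection of the [ir I] primes [star A (P i)], which gives the
    inequality.  If equality holds, this second decomposition is a shortest one
    too, so it lists the minimal primes of [star A I] without repetition, and
    [star A] is a bijection because [P] lists those of [I].  Conversely a
    bijection between the sets of minimal primes forces the two counts to
    agree ([bij_Min_ir_le]). *)

(** * Ideals, primes and irreducible decompositions *)

Section IdealsAndPrimes.
Variable R : comPzRingType.
Implicit Types I J P Q : set R.

Lemma ideal_sum I (T : Type) (s : seq T) (p : pred T) (F : T -> R) :
  is_ideal I -> (forall t, p t -> I (F t)) -> I (\sum_(t <- s | p t) F t).
Proof. by case=> I0 ID _ IF; elim/big_ind: _. Qed.

Lemma idealB I x y : is_ideal I -> I x -> I y -> I (x - y).
Proof. by case=> _ ID IM Ix Iy; apply: ID => //; rewrite -mulN1r; apply: IM. Qed.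

Lemma ideal_bigcap (T : Type) (J : T -> set R) :
  (forall t, is_ideal (J t)) -> is_ideal (\bigcap_t J t).
Proof.
move=> idJ; split=> [t _|x y Jx Jy t _|a x Jx t _]; have [J0 JD JM] := idJ t.
- by [].
- by apply: JD; [apply: Jx|apply: Jy].
- by apply: JM; apply: Jx.
Qed.

Lemma radical_ideal I : is_ideal I -> is_ideal (radical I).
Proof.
move=> idI; have [I0 ID IM] := idI.
split=> [|x y [n xn] [m ym]|a x [n xn]].
- by exists 1%N; rewrite expr1.
- exists (n + m)%N; rewrite exprDn; apply: ideal_sum => // i _.
  rewrite -mulr_natl; apply: (IM).
  (* In degree n + m either y occurs at least m times or x at least n times. *)
  have [le_mi|lt_im] := leqP m i.
    by rewrite -(subnK le_mi) exprD mulrA; apply: (IM).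
  by rewrite -addnBA 1?ltnW// addnC exprD mulrAC; apply: (IM).
- by exists n; rewrite exprMn; apply: (IM).
Qed.

Lemma sub_radical I : I `<=` radical I.
Proof. by move=> x Ix; exists 1%N; rewrite expr1. Qed.

Lemma prime_ideal P : is_prime P -> is_ideal P.
Proof. by case. Qed.

Lemma prime_radical P : is_prime P -> radical P `<=` P.
Proof.
move=> [_ P1 PM] x [n]; elim: n => [|n IHn]; first by rewrite expr0.
by rewrite exprS => /PM[|/IHn].
Qed.

Lemma radical_prime_cap (T : Type) (P : T -> set R) :
  (forall t, is_prime (P t)) -> is_radical_ideal (\bigcap_t P t).
Proof.
move=> prP; split; first by apply: ideal_bigcap => t; apply: prime_ideal.
apply/seteqP; split; last exact: sub_radical.
by move=> x [n xn] t _; apply: prime_radical => //; exists n; apply: xn.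
Qed.

Lemma prime_irreducible P : is_prime P -> is_irreducible P.
Proof.
move=> [idP _ PM]; split=> // I1 I2 [_ _ M1] [_ _ M2] eP.
apply: contrapT => /not_orP[n1 n2].
have outside J : P `<=` J -> J <> P -> exists2 x, J x & ~ P x.
  move=> PJ nJ; apply: contrapT => none; apply: nJ; apply/seteqP; split=> // x Jx.
  by apply: contrapT => nPx; apply: none; exists x.
have [|x x1 nx] := outside I1 _ n1; first by rewrite -eP => ? [].
have [|y y2 ny] := outside I2 _ n2; first by rewrite -eP => ? [].
have /PM[] // : P (x * y).
by rewrite -eP; split; [rewrite mulrC; apply: M1|apply: M2].
Qed.

(** If every [J i] had an element outside [P], the product of these elements
    would be in the intersection but not in [P]. *)
Lemma prime_avoid_cap (r : nat) (J : 'I_r -> set R) P :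
    (forall i, is_ideal (J i)) -> is_prime P -> \bigcap_i J i `<=` P ->
  exists i, J i `<=` P.
Proof.
move=> idJ [[P0 PD PZ] P1 PM] capP; apply: contrapT => none.
have [f fP] : {f : 'I_r -> R & forall i, J i (f i) /\ ~ P (f i)}.
  apply: (@choice _ _ (fun i x => J i x /\ ~ P x)) => i; apply: contrapT => nonei; apply: none; exists i => x Jx.
  by apply: contrapT => nPx; apply: nonei; exists x.
suff nP : ~ P (\prod_i f i).
  apply/nP/capP.
  move=> i _; rewrite (bigD1 i) //= mulrC; case: (idJ i) => _ _; apply.
  by case: (fP i).
by elim/big_ind: _ => [//|x y nx ny /PM[]//|i _]; case: (fP i).
Qed.

(** Noether's argument: the ideals [J : x ^ n] stabilize at some [n], and then
    [J] is the intersection of [J + (x ^ n)] and [J + (y)], so irreducibility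
    puts [x ^ n] or [y] in [J]. *)
Lemma irreducible_primary J x y :
  noetherian R -> is_irreducible J -> J (x * y) -> J y \/ radical J x.
Proof.
move=> noeth [[J0 JD JM] irrJ] Jxy.
pose quo n : set R := [set a | J (a * x ^+ n)].
have [||n quon] := noeth quo.
- move=> n; split=> [|a b|a b]; rewrite /quo /= ?mul0r// ?mulrDl.
    exact: JD.
  by rewrite -mulrA; apply: JM.
- by move=> n a; rewrite /quo /= exprSr mulrA [_ * x]mulrC; apply: JM.
pose J' z : set R := [set w | exists j a, J j /\ w = j + a * z].
have idJ' z : is_ideal (J' z).
  split=> [|w1 w2 [j1 [a1 [Jj1 ->]]] [j2 [a2 [Jj2 ->]]]|b w [j [a [Jj ->]]]].
  - by exists 0, 0; rewrite mul0r addr0.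
  - by exists (j1 + j2), (a1 + a2); rewrite mulrDl addrACA; split=> //; apply: JD.
  - by exists (b * j), (b * a); rewrite mulrDr mulrA; split=> //; apply: JM.
have J'z z : J' z z by exists 0, 1; rewrite mul1r add0r.
have JJ' z : J `<=` J' z by move=> j Jj; exists j, 0; rewrite mul0r addr0.
suff eJ : J' (x ^+ n) `&` J' y = J.
  have [e|e] := irrJ _ _ (idJ' (x ^+ n)) (idJ' y) eJ; last by left; rewrite -e.
  by right; exists n; rewrite -e.
apply/seteqP; split=> [w|w Jw]; last by split; apply: JJ'.
(* An element j + a x^n that also lies in J + (y) is sent into J by x, since
   x y is in J; so a is in (J : x^(n+1)), which is (J : x^n). *)
case=> -[j [a [Jj ->]]] [j2 [b [Jj2 ew]]]; apply: (JD) => //.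
have Jxw : J (x * (j + a * x ^+ n)).
  rewrite ew mulrDr; apply: (JD); first exact: JM.
  by rewrite mulrCA; apply: JM.
have : quo n.+1 a.
  have -> : quo n.+1 a = J (x * (j + a * x ^+ n) - x * j).
    by rewrite mulrDr addrC addKr /quo /= exprS mulrCA.
  by apply: idealB => //; apply: JM.
by rewrite quon.
Qed.

(** Irreducibility does not exclude the unit ideal, whose radical is not prime. *)
Lemma irreducible_radical_prime J :
  noetherian R -> is_irreducible J -> ~ J 1 -> is_prime (radical J).
Proof.
move=> noeth irrJ nJ1; split; first by apply: radical_ideal; case: irrJ.
  by case=> n; rewrite expr1n.
move=> x y [n]; rewrite exprMn => /(irreducible_primary noeth irrJ)[Jy|[m]].
  by right; exists n.
by rewrite -exprM => Jx; left; exists (n * m)%N.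
Qed.

(** A redundant component could be dropped, giving a shorter decomposition. *)
Lemma ir_irredundant I (J : 'I_(ir I) -> set R) (i : 'I_(ir I)) :
    noetherian R -> is_ideal I -> (forall i, is_irreducible (J i)) ->
    I = \bigcap_i J i ->
  ~ (\bigcap_(j in [set j | j != i]) J j `<=` J i).
Proof.
move=> noeth idI; have [_] := irP noeth idI.
case: (ir I) J i => [|r] J i rmin irrJ eI sub; first by case: i sub.
suff /rmin : irreducible_decomposition I r by rewrite ltnn.
exists (fun k => J (lift i k)); split=> //; rewrite eI.
apply/seteqP; split=> x xJ k _; first exact: xJ.
have Jne j : j != i -> J j x.
  by case: (unliftP i j) => [k' ->|->]; [move=> _; apply: xJ|rewrite eqxx].
by have [->|/Jne//] := eqVneq k i; apply: sub => j; apply: Jne.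
Qed.

(** The radicals of the components of a shortest irreducible decomposition;
    irredundancy rules out unit components. *)
Lemma radical_ir_primes I : noetherian R -> is_radical_ideal I ->
  exists P : 'I_(ir I) -> set R,
    (forall i, is_prime (P i)) /\ I = \bigcap_i P i.
Proof.
move=> noeth [idI radI]; have [[J [irrJ eI]] _] := irP noeth idI.
exists (fun i => radical (J i)); split.
  move=> i; apply: irreducible_radical_prime => // J1.
  apply: (ir_irredundant noeth idI irrJ eI (i := i)) => x _.
  by case: (irrJ i) => -[_ _ JM] _; rewrite -[x]mulr1; apply: JM.
have eIx x : I x = (\bigcap_i J i) x := congr1 (@^~ x) eI.
apply/seteqP; split=> x; first by rewrite eIx => xJ i _; apply/sub_radical/xJ.
move=> xJ; have [n nP] := choice (fun i => xJ i Logic.I).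
(* The exponents n i depend on i; their sum works for all components. *)
rewrite -radI; exists (\sum_i n i)%N; rewrite eIx => i _.
rewrite (bigD1 i) //= addnC exprD.
by case: (irrJ i) => -[_ _ JM] _; apply: (JM).
Qed.

(** A prime over [I] contains some [P j], and irredundancy makes the [P i]
    pairwise incomparable.  The length is a variable [r] rather than [ir I] so
    that the lemma also applies to a decomposition indexed by [ir] of another
    ideal. *)
Lemma ir_primes_Min I (r : nat) (P : 'I_r -> set R) : noetherian R ->
    r = ir I -> (forall i, is_prime (P i)) -> I = \bigcap_i P i ->
  set_bij setT (Min I) P.
Proof.
move=> noeth er; subst r => prP eI.
have idP i : is_ideal (P i) by apply: prime_ideal.
have eIx x : I x = (\bigcap_i P i) x := congr1 (@^~ x) eI.
have PI i : I `<=` P i by move=> x; rewrite eIx; apply.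
have idI : is_ideal I by rewrite eI; apply: ideal_bigcap.
have anti i j : P j `<=` P i -> j = i.
  move=> sPji; apply/eqP; apply: contrapT => /negP nji.
  apply: (@ir_irredundant I P i) => // [k|x xP]; first exact: prime_irreducible.
  by apply/sPji/xP.
have above Q : is_prime Q -> I `<=` Q -> exists j, P j `<=` Q.
  by move=> prQ IQ; apply: prime_avoid_cap => // x; rewrite -eIx; apply: IQ.
have minP i : Min I (P i).
  split=> // Q prQ IQ QP.
  apply/seteqP; split=> //.
  have [j PQ] := above Q prQ IQ.
  by rewrite -(anti i j) // => x /PQ /QP.
split=> [i _ //|i j _ _ eP|Q [prQ IQ minQ]]; first by apply: anti; rewrite eP.
have [j PQ] := above Q prQ IQ; exists j => //.
exact: minQ.
Qed.

End IdealsAndPrimes.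

(** * Torsionfree abelian groups are orderable *)

Section Order.
Variable G : zmodType.

(** Zero is not required to belong to a cone: in Zorn's lemma the union of the
    empty chain must be a cone as well.  It is adjoined at the end. *)
Definition add_closed (C : set G) := forall a b, C a -> C b -> C (a + b).
Definition pointed (C : set G) := forall a, C a -> C (- a) -> a = 0.

Lemma add_closed0 (C : set G) :
  add_closed C -> add_closed [set a | a = 0 \/ C a].
Proof.
move=> CD a b [->|Ca] [->|Cb]; rewrite ?addr0 ?add0r; [by left|by right|by right|].
by right; apply: CD.
Qed.

Lemma add_closedMn (C : set G) a n :
  add_closed C -> (a = 0 \/ C a) -> (a *+ n = 0 \/ C (a *+ n)).
Proof.
move=> CD [->|Ca]; first by left; rewrite mul0rn.
elim: n => [|n [e|Cn]]; first by left.
  by right; rewrite mulrS e addr0.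
by right; rewrite mulrS; apply: CD.
Qed.

Lemma maximal_cone : exists C : set G,
  [/\ add_closed C, pointed C &
      forall D, add_closed D -> pointed D -> C `<=` D -> D `<=` C].
Proof.
have [|C [[CD Cp] Cmax]] :=
  @Zorn_bigcup G [set C | add_closed C /\ pointed C].
  move=> F FP Ftot; split=> [a b [X FX Xa] [Y FY Yb]|a [X FX Xa] [Y FY Yb]].
    have [XY|YX] := Ftot X Y FX FY.
      by exists Y => //; case: (FP Y FY) => YD _; apply: YD => //; apply: XY.
    by exists X => //; case: (FP X FX) => XD _; apply: XD => //; apply: YX.
  have [XY|YX] := Ftot X Y FX FY.
    by case: (FP Y FY) => _; apply => //; apply: XY.
  by case: (FP X FX) => _; apply => //; apply: YX.
exists C; split=> // D DD Dp CsubD; apply: contrapT => nDC.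
by apply: (Cmax D).
Qed.

(** Enlarging the cone by the nonnegative multiples of [g] would contradict
    maximality unless the enlarged set is not pointed; a nonzero element there
    whose opposite also belongs to it yields a positive multiple of [- g] in the
    cone. *)
Lemma maximal_cone_neg (C : set G) (g : G) :
    add_closed C -> pointed C ->
    (forall D, add_closed D -> pointed D -> C `<=` D -> D `<=` C) ->
    ~ (g = 0 \/ C g) ->
  exists2 n, (0 < n)%N & - g *+ n = 0 \/ C (- g *+ n).
Proof.
move=> CD Cp Cmax ng; pose C0 : set G := [set a | a = 0 \/ C a].
have C0D : add_closed C0 := add_closed0 CD.
pose D : set G := [set z | exists c n, C0 c /\ z = c + g *+ n].
have DD : add_closed D.
  move=> _ _ [c [n [Cc ->]]] [d [m [Cd ->]]]; exists (c + d), (n + m)%N.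
  by rewrite mulrnDr addrACA; split=> //; apply: C0D.
have CsubD : C `<=` D.
  by move=> c Cc; exists c, 0%N; rewrite mulr0n addr0; split=> //; right.
have Dg : D g by exists 0, 1%N; rewrite mulr1n add0r; split=> //; left.
apply: contrapT => none; apply: ng; right; apply: (Cmax D) => //.
move=> a [c [n [Cc ea]]] [d [m [Cd eNa]]].
have eqcd : - g *+ (n + m) = c + d.
  rewrite mulNrn; apply/eqP; rewrite eq_sym -addr_eq0 mulrnDr addrACA.
  by rewrite -ea -eNa subrr.
have [nm0|nm_gt0] := posnP (n + m)%N; last first.
  by case: none; exists (n + m)%N => //; rewrite eqcd; apply: C0D.
move/eqP: nm0; rewrite addn_eq0 => /andP[/eqP n0 /eqP m0].
move: ea eNa; rewrite n0 m0 !mulr0n !addr0 => ea eNa.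
case: Cc => [c0|Cc]; first by rewrite ea.
case: Cd => [d0|Cd]; first by apply/eqP; rewrite -oppr_eq0 eNa d0.
by apply: Cp; rewrite ?ea// -ea eNa.
Qed.

(** The set of nonnegative elements of a compatible total order, obtained from a
    maximal cone [C] with zero adjoined.  If neither [g] nor [- g] were in it,
    then positive multiples of both would be, say of [- g] by [n] and of [g] by
    [m]; so [g *+ (m * n)] and its opposite would be, hence [g *+ (m * n)] would
    vanish, which torsionfreeness excludes. *)
Lemma torsionfree_order : torsionfree G -> exists C : set G,
  [/\ C 0, add_closed C, pointed C & forall g, C g \/ C (- g)].
Proof.
move=> tf; have [C [CD Cp Cmax]] := maximal_cone.
exists [set a | a = 0 \/ C a]; split=> [||a|g] /=.
- by left.
- exact: add_closed0.
- move=> [//|Ca] [/eqP|]; first by rewrite oppr_eq0 => /eqP.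
  exact: Cp.
- apply: contrapT => /not_orP[ng nNg].
  have [n n_gt0 Cn] := maximal_cone_neg CD Cp Cmax ng.
  have [m m_gt0] := maximal_cone_neg CD Cp Cmax nNg; rewrite opprK => Cm.
  have g0 : g *+ (m * n) = 0 -> g = 0 by apply: tf; rewrite muln_gt0 m_gt0.
  apply: ng; left; apply: g0.
  have := add_closedMn m CD Cn; rewrite -mulrnA mulNrn mulnC => Cmn.
  case: Cmn => [/eqP|Cmn]; first by rewrite oppr_eq0 => /eqP.
  by have := add_closedMn n CD Cm; rewrite -mulrnA => -[//|]; move/Cp; apply.
Qed.

(** A nonempty set of degrees contained in a finite list has a greatest element
    for the total preorder whose nonnegative elements are [C]. *)
Lemma cone_max (C : set G) (S : set G) (s : seq G) :
    C 0 -> add_closed C -> (forall g, C g \/ C (- g)) ->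
    (forall g, S g -> g \in s) -> (exists g, S g) ->
  exists2 g, S g & forall h, S h -> C (g - h).
Proof.
move=> C0 CD Ctot Ss [g0 Sg0].
have [g Sg gmax] : exists2 g, S g & forall h, h \in s -> S h -> C (g - h).
  elim: s {Ss} => [|k s [g Sg gmax]]; first by exists g0.
  have [[Sk Ckg]|nk] := pselect (S k /\ C (k - g)).
    exists k => // h; rewrite inE => /orP[/eqP->|hs Sh]; first by rewrite subrr.
    by rewrite -(subrKA g); apply: CD => //; apply: gmax.
  exists g => // h; rewrite inE => /orP[/eqP->|]; last exact: gmax.
  move=> Sk; case: (Ctot (g - k)) => //; rewrite opprB => Ckg.
  by case: nk.
by exists g => // h Sh; apply: gmax => //; apply: Ss.
Qed.

End Order.

(** * Homogeneous components and the graded part of an ideal *)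

Section Components.
Variables (G : zmodType) (R : comPzRingType) (A : G -> set R).
Hypothesis gradA : is_grading A.
Implicit Types (I P : set R) (s : seq G) (f : G -> R).

(** The coefficients form a total function that vanishes off [s], so that
    uniqueness of the decomposition is an equality of functions, whatever lists
    are used. *)
Definition decomposes (x : R) s f : Prop :=
  [/\ uniq s, forall g, A g (f g), forall g, g \notin s -> f g = 0
    & x = \sum_(g <- s) f g].

Definition comp (x : R) : G -> R :=
  xget (fun=> 0) [set f | exists s, decomposes x s f].

Lemma gradingD g x y : A g x -> A g y -> A g (x + y).
Proof.
move=> Ax Ay; rewrite -[y]opprK; apply: (gradingB gradA) => //.
by rewrite -sub0r; apply: (gradingB gradA) => //; apply: grading0.
Qed.

Lemma big_support s s' f : uniq s -> uniq s' -> {subset s <= s'} ->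
  (forall g, g \notin s -> f g = 0) -> \sum_(g <- s) f g = \sum_(g <- s') f g.
Proof.
move=> us us' ss f0; rewrite [RHS](bigID (mem s)) /=.
rewrite [X in _ = _ + X](_ : _ = 0) ?addr0; last by apply: big1 => g /f0.
rewrite -[RHS]big_filter; apply: perm_big; apply: uniq_perm => //.
  exact: filter_uniq.
by move=> g; rewrite mem_filter /=; case gs: (g \in s) => //=; rewrite ss.
Qed.

Lemma decomposes_uniq x s s' f f' :
  decomposes x s f -> decomposes x s' f' -> f = f'.
Proof.
move=> [us Af f0 ex] [us' Af' f'0 ex'].
pose t := undup (s ++ s').
have ut : uniq t := undup_uniq _.
have st : {subset s <= t} by move=> g gs; rewrite mem_undup mem_cat gs.
have s't : {subset s' <= t} by move=> g gs; rewrite mem_undup mem_cat gs orbT.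
apply: funext => g; have [gt|ngt] := boolP (g \in t); last first.
  by rewrite (f0 _ (contra (@st g) ngt)) (f'0 _ (contra (@s't g) ngt)).
apply/eqP; rewrite -subr_eq0; apply/eqP.
apply: (grading_free gradA (c := fun g => f g - f' g) ut) => // [h _|].
  exact: (gradingB gradA).
by rewrite sumrB -(big_support us ut st f0) -(big_support us' ut s't f'0) -ex -ex' subrr.
Qed.

Lemma decomposes_exists x : exists f s, decomposes x s f.
Proof.
have [s [c [us Ac ex]]] := grading_span gradA x.
exists (fun g => if g \in s then c g else 0), s; split=> //.
- by move=> g; case: ifP => [/Ac//|_]; apply: (grading0 gradA).
- by move=> g /negbTE ->.
- by rewrite ex; apply: eq_big_seq => g ->.
Qed.

Lemma compP x : exists s, decomposes x s (comp x).
Proof. exact: (xgetPex (fun=> 0) (decomposes_exists x)). Qed.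

Lemma comp_eq x s f : decomposes x s f -> comp x = f.
Proof. by move=> xf; have [s' xc] := compP x; apply: decomposes_uniq xc xf. Qed.

Lemma comp_of_homogeneous g x :
  A g x -> comp x = fun h => if h == g then x else 0.
Proof.
move=> Ax; apply: (@comp_eq _ [:: g]); split=> //.
- by move=> h; case: eqP => [->//|_]; apply: (grading0 gradA).
- by move=> h; rewrite inE => /negbTE ->.
- by rewrite big_seq1 eqxx.
Qed.

Lemma comp0 g : comp 0 g = 0.
Proof. by rewrite (comp_of_homogeneous (grading0 gradA 0)); case: ifP. Qed.

Lemma compD x y g : comp (x + y) g = comp x g + comp y g.
Proof.
have [s [us Ax x0 ex]] := compP x; have [t [ut Ay y0 ey]] := compP y.
pose u := undup (s ++ t).
have uu : uniq u := undup_uniq _.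
have su : {subset s <= u} by move=> h hs; rewrite mem_undup mem_cat hs.
have tu : {subset t <= u} by move=> h ht; rewrite mem_undup mem_cat ht orbT.
suff xyD : decomposes (x + y) u (fun h => comp x h + comp y h).
  by rewrite (comp_eq xyD).
split=> // [h|h hu|]; first exact: gradingD.
  by rewrite (x0 _ (contra (@su h) hu)) (y0 _ (contra (@tu h) hu)) addr0.
by rewrite big_split /= -(big_support us uu su x0) -(big_support ut uu tu y0) -ex -ey.
Qed.

Lemma comp_sum (T : Type) (s : seq T) (F : T -> R) g :
  comp (\sum_(t <- s) F t) g = \sum_(t <- s) comp (F t) g.
Proof.
elim: s => [|t s IHs]; first by rewrite !big_nil comp0.
by rewrite !big_cons compD IHs.
Qed.

Lemma comp_homM h a x g : A h a -> comp (a * x) g = a * comp x (g - h).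
Proof.
move=> Aa; have [s [us Ax x0 ex]] := compP x.
suff -> : comp (a * x) = fun k => a * comp x (k - h) by [].
apply: (@comp_eq _ [seq h + k | k <- s]); split.
- by rewrite map_inj_uniq//; apply: addrI.
- by move=> k; rewrite -{1}(subrKC h k); apply: (gradingM gradA).
- move=> k ks; rewrite x0 ?mulr0//; apply: contra ks => ks.
  by apply/mapP; exists (k - h) => //; rewrite subrKC.
- rewrite big_map {1}ex mulr_sumr; apply: eq_bigr => k _.
  by rewrite addrC addKr.
Qed.

Lemma compM x y : exists2 s : seq G,
  uniq s /\ (forall g, g \notin s -> comp x g = 0) &
  forall g, comp (x * y) g = \sum_(h <- s) comp x h * comp y (g - h).
Proof.
have [s [us Ax x0 ex]] := compP x; exists s => // g.
rewrite {1}ex mulr_suml comp_sum; apply: eq_bigr => h _.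
exact: comp_homM.
Qed.

(** The right-hand side is an ideal by [compM], contains the homogeneous elements
    of [I], and each of its elements is a sum of such elements. *)
Lemma starE I : is_ideal I -> star A I = [set x | forall g, I (comp x g)].
Proof.
move=> idI; have [I0 ID IM] := idI; apply/seteqP; split.
  apply: smallest_sub.
    split=> [g|x y Ix Iy g|a x Ix g]; first by rewrite comp0.
      by rewrite compD; apply: ID; [apply: Ix|apply: Iy].
    have [s _ ->] := compM a x; apply: ideal_sum => // h _.
    by apply: (IM); apply: Ix.
  move=> x [Ix [h Ahx]] g; rewrite (comp_of_homogeneous Ahx).
  by case: ifP.
move=> x Ix; have [s [us Ax x0 ex]] := compP x.
move=> J [idJ IJ]; rewrite ex; apply: ideal_sum => // g _.
by apply: IJ; split; [apply: Ix|exists g].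
Qed.

Lemma star_ideal I : is_ideal (star A I).
Proof.
split=> [J [[J0 _ _] _]//|x y Ix Iy J IJ|a x Ix J IJ]; have [[_ JD JM] _] := IJ.
  by apply: JD; [apply: Ix|apply: Iy].
by apply: JM; apply: Ix.
Qed.

Lemma star_sub I : is_ideal I -> star A I `<=` I.
Proof. by move=> idI; apply: smallest_sub => // x []. Qed.

Lemma star_bigcap (T : Type) (J : T -> set R) :
    (forall t, is_ideal (J t)) ->
  star A (\bigcap_t J t) = \bigcap_t star A (J t).
Proof.
move=> idJ; rewrite starE; last exact: ideal_bigcap.
apply/seteqP; split=> x.
  by move=> xJ t _; rewrite starE// => g; apply: xJ.
by move=> xJ g t _; have := xJ t Logic.I; rewrite starE//; apply.
Qed.

(** For [x] and [y] outside [star A P], let [g] and [h] be the greatest degrees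
    of components of [x] and [y] outside [P].  In the component of [x * y] of
    degree [g + h], every term other than [comp x g * comp y h] has a factor of
    greater degree than [g] or [h], hence a factor in [P]. *)
Lemma star_prime P : torsionfree G -> is_prime P -> is_prime (star A P).
Proof.
move=> /torsionfree_order[C [C0 CD Cp Ctot]] [idP P1 PM].
have [P0 PD PZ] := idP.
have lead x : ~ star A P x ->
    exists2 g, ~ P (comp x g) & forall h, ~ P (comp x h) -> C (g - h).
  rewrite starE// => /existsNP[g Pg]; have [s [_ _ x0 _]] := compP x.
  apply: (@cone_max _ C [set g | ~ P (comp x g)] s) => //; last by exists g.
  by move=> h Ph; apply: contrapT => /negP /x0 xh; apply: Ph; rewrite xh.
split.
- exact: star_ideal.
- by move/(star_sub idP).
move=> x y; rewrite {1}starE// => Pxy.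
apply: contrapT => /not_orP[/lead[g Pg gmax] /lead[h Ph hmax]].
have [s [us x0] xyE] := compM x y.
have gs : g \in s by apply: contrapT => /negP /x0 xg; apply: Pg; rewrite xg.
suff Pxy_lead : P (comp x g * comp y h) by case: (PM _ _ Pxy_lead).
have := Pxy (g + h); rewrite xyE (bigD1_seq g) //= [g + h]addrC addrK => Psum.
rewrite -[_ * _](addrK (\sum_(k <- s | k != g) comp x k * comp y (h + g - k))).
apply: idealB => //; apply: ideal_sum => // k nkg.
have [Pk|nPk] := pselect (P (comp x k)); first by rewrite mulrC; apply: PZ.
(* Otherwise the maximality of g and h makes both g - k and k - g nonnegative. *)
apply: PZ; apply: contrapT => nPhk; case/eqP: nkg.
apply/eqP; rewrite eq_sym -subr_eq0; apply/eqP; apply: Cp; first exact: gmax.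
by have := hmax _ nPhk; rewrite -addrA opprD addrA subrr add0r.
Qed.

End Components.

(** * Comparison of the indices of reducibility *)

Lemma bij_Min_ir_le (R : comPzRingType) (I J : set R) (f : set R -> set R) :
    noetherian R -> is_radical_ideal I -> is_radical_ideal J ->
    set_bij (Min I) (Min J) f ->
  (ir I <= ir J)%N.
Proof.
move=> noeth radI radJ bijf.
have [P [prP eI]] := radical_ir_primes noeth radI.
have [Q [prQ eJ]] := radical_ir_primes noeth radJ.
have [fP injP _] := set_bij_comp (ir_primes_Min noeth erefl prP eI) bijf.
have [_ _ surQ] := ir_primes_Min noeth erefl prQ eJ.
have [k kP] : {k : 'I_(ir I) -> 'I_(ir J) & forall i, Q (k i) = f (P i)}.
  by apply: (@choice _ _ (fun i j => Q j = f (P i))) => i; have [j _ ej] := surQ _ (fP i Logic.I); exists j.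
rewrite -(card_ord (ir I)) -(card_ord (ir J)); apply: (leq_card k) => i j eij.
by apply: injP; rewrite ?inE//= -!kP eij.
Qed.

Theorem theorem5p1 (G : zmodType) (R : comPzRingType) (A : G -> set R)
    (I : set R) :
  torsionfree G ->
  noetherian R ->
  is_grading A ->
  is_radical_ideal I ->
  ~ is_graded_ideal A I ->
  (ir (star A I) <= ir I)%N /\
  (ir I = ir (star A I) <-> set_bij (Min I) (Min (star A I)) (star A)).
Proof.
move=> tf noeth gradA radI _.
have [P [prP eI]] := radical_ir_primes noeth radI.
have idP i : is_ideal (P i) by apply: prime_ideal.
have prS i : is_prime (star A (P i)) by apply: star_prime.
have eS : star A I = \bigcap_i star A (P i) by rewrite {1}eI star_bigcap.
have radS : is_radical_ideal (star A I).
  by rewrite eS; apply: radical_prime_cap.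
have le_ir : (ir (star A I) <= ir I)%N.
  have [_] := irP noeth radS.1; apply.
  by exists (fun i => star A (P i)); split=> // i; apply: prime_irreducible.
split=> //; split=> [e|bij]; last first.
  by apply/eqP; rewrite eqn_leq le_ir (bij_Min_ir_le noeth radI radS bij).
have [PMin injP surP] := ir_primes_Min noeth erefl prP eI.
(* By e, the primes star A (P i) form a shortest decomposition of star A I. *)
have [SMin injS surS] : set_bij setT (Min (star A I)) (star A \o P).
  exact: ir_primes_Min.
split.
- by move=> Q /surP[i _ <-]; apply: SMin.
- move=> Q Q'; rewrite !inE => /surP[i _ <-] /surP[j _ <-] eQ.
  by congr P; apply: injS; rewrite ?inE.
- by move=> Q /surS[i _ <-]; exists (P i) => //; apply: PMin.
Qed.
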